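(* Let $k$ be a positive integer and consider the $k$-th order system of two rational difference equations $$x_n=\frac{\alpha+\sum^{k}_{i=1}\beta_{i}x_{n-i} + \sum^{k}_{i=1}\gamma_{i}y_{n-i}}{A+\sum^{k}_{j=1}B_{j}x_{n-j} + \sum^{k}_{j=1}C_{j}y_{n-j}},\qquad y_n=\frac{p+\sum^{k}_{i=1}\delta_{i}x_{n-i} + \sum^{k}_{i=1}\epsilon_{i}y_{n-i}}{q+\sum^{k}_{j=1}D_{j}x_{n-j} + \sum^{k}_{j=1}E_{j}y_{n-j}},\qquad n\in\mathbb{N},$$ with non-negative real parameters and non-negative initial conditions. Suppose that $A>0$, $I_\gamma\subseteq I_C$, and there exists a positive integer $\eta$ such that for every sequence $\{c_m\}_{m=1}^\infty$ with $c_m\in I_\beta$ for all $m\ge 1$ there exist positive integers $N_1,N_2\le\eta$ such that $\sum_{m=N_1}^{N_2}c_m\in I_B$. Then there exist $M>0$ and $N\in\mathbb{N}$ such that every solution (from any non-negative initial conditions) satisfies $x_n\le M$ for all $n>N$.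
   Context: $\mathbb{N}=\{1,2,\dots\}$. Initial conditions are $x_{1-k},\dots,x_0,y_{1-k},\dots,y_0\ge 0$; a solution is a pair of sequences generated by the system from non-negative initial conditions for which all denominators are positive for every $n\in\mathbb{N}$. Index sets in $\{1,\dots,k\}$: $I_\beta=\{i:\beta_i>0\}$, $I_\gamma=\{i:\gamma_i>0\}$, $I_B=\{j:B_j>0\}$, $I_C=\{j:C_j>0\}$. A sum $\sum_{m=N_1}^{N_2}$ with $N_1>N_2$ is empty and equals $0$. *)

(* Defs.v *)
From HB Require Import structures.
From mathcomp Require Import all_boot all_order all_algebra.
From mathcomp Require Import reals.

Set Implicit Arguments.
Unset Strict Implicit.
Unset Printing Implicit Defensive.

Import Order.TTheory GRing.Theory Num.Theory.
Local Open Scope ring_scope.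

(* Coefficients of
     x_n = (alpha + sum beta_i x_(n-i) + sum gamma_i y_(n-i))
             / (A + sum B_j x_(n-j) + sum C_j y_(n-j)),
     y_n = (p + sum delta_i x_(n-i) + sum epsilon_i y_(n-i))
             / (q + sum D_j x_(n-j) + sum E_j y_(n-j)),
   with i, j ranging over 1, ..., k.  The families are functions on nat of which
   only the values at 1, ..., k (k being supplied separately) are ever used. *)
Record rational_system (R : realType) := RationalSystem {
  alpha : R; beta : nat -> R; gamma : nat -> R;
  cA : R; cB : nat -> R; cC : nat -> R;
  cp : R; delta : nat -> R; epsilon : nat -> R;
  cq : R; cD : nat -> R; cE : nat -> R
}.

Definition nonneg_family (R : realType) (k : nat) (b : nat -> R) : Prop :=
  forall i : nat, (1 <= i <= k)%N -> 0 <= b i.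

Definition nonneg_params (R : realType) (k : nat) (sys : rational_system R) : Prop :=
  [/\ [/\ 0 <= alpha sys, nonneg_family k (beta sys) & nonneg_family k (gamma sys)],
      [/\ 0 <= cA sys, nonneg_family k (cB sys) & nonneg_family k (cC sys)],
      [/\ 0 <= cp sys, nonneg_family k (delta sys) & nonneg_family k (epsilon sys)] &
      [/\ 0 <= cq sys, nonneg_family k (cD sys) & nonneg_family k (cE sys)]].

Definition index_set (R : realType) (k : nat) (b : nat -> R) : pred nat :=
  [pred i | (1 <= i <= k)%N && (0 < b i)].

Definition affine_form (R : realType) (k : nat) (a : R) (b c : nat -> R)
    (x y : int -> R) (n : nat) : R :=
  a + \sum_(1 <= i < k.+1) b i * x (n%:Z - i%:Z)
    + \sum_(1 <= i < k.+1) c i * y (n%:Z - i%:Z).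

Section Solutions.
Variables (R : realType) (k : nat) (sys : rational_system R).

Definition x_num := affine_form k (alpha sys) (beta sys) (gamma sys).
Definition x_den := affine_form k (cA sys) (cB sys) (cC sys).
Definition y_num := affine_form k (cp sys) (delta sys) (epsilon sys).
Definition y_den := affine_form k (cq sys) (cD sys) (cE sys).

(* Sequences are indexed by int so that x_(1-k), ..., x_0 keep their indices;
   values at indices below 1 - k are irrelevant. *)
Definition is_solution (x y : int -> R) : Prop :=
  (forall m : int, 1 - k%:Z <= m <= 0 -> 0 <= x m /\ 0 <= y m) /\
  (forall n : nat, (1 <= n)%N ->
     [/\ 0 < x_den x y n, 0 < y_den x y n,
         x n%:Z = x_num x y n / x_den x y n &
         y n%:Z = y_num x y n / y_den x y n]).

End Solutions.

(* Main.v *)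
(** Each term of the [x]-numerator other than the [beta_i x_(n-i)] is at most a
    constant times the denominator, so [x_n <= K + sum beta_i x_(n-i) / den_n].
    Hence if [x_n > 2K], some [i] in [I_beta] has [x_(n-i) >= c den_n x_n], with
    [c > 0] depending only on the [beta_i].  Starting at a very large [x_n],
    these [i] produce a descending path of indices along which [x] loses at most
    a bounded factor at each of the first [eta] steps.  If a block of steps,
    from [u] down to [v], adds up to some [j] in [I_B], then
    [den_u >= B_j x_v], so the first step of the block gives
    [x_v >= r^eta c B_j x_v x_u], which bounds [x_u] and therefore [x_n]. *)

Require Import Defs.
From HB Require Import structures.
From mathcomp Require Import all_boot all_order all_algebra.
From mathcomp Require Import reals zify ring lra.

Set Implicit Arguments.
Unset Strict Implicit.
Unset Printing Implicit Defensive.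

Import Order.TTheory GRing.Theory Num.Theory.
Local Open Scope ring_scope.

(** * Sums of non-negative terms and lower bounds for affine forms *)

Lemma sumr_nat_ge0 (R : numDomainType) (m n : nat) (F : nat -> R) :
  (forall i, (m <= i < n)%N -> 0 <= F i) -> 0 <= \sum_(m <= i < n) F i.
Proof. by move=> F0; rewrite big_nat_cond; apply: sumr_ge0 => i /andP[/F0]. Qed.

Lemma ler_term_sum_nat (R : numDomainType) (m n j : nat) (F : nat -> R) :
  (forall i, (m <= i < n)%N -> 0 <= F i) -> (m <= j < n)%N ->
  F j <= \sum_(m <= i < n) F i.
Proof.
move=> F0 jP; rewrite (bigD1_seq j) ?iota_uniq ?mem_index_iota //= lerDl.
rewrite big_seq_cond; apply: sumr_ge0 => i /andP[].
by rewrite mem_index_iota => /F0.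
Qed.

Section AffineForm.
Variables (R : realType) (k : nat) (a : R) (b c : nat -> R).
Variables (x y : int -> R) (n : nat).
Hypotheses (a_ge0 : 0 <= a) (b_ge0 : nonneg_family k b)
  (c_ge0 : nonneg_family k c).
Hypothesis xy_ge0 : forall i : nat, (1 <= i <= k)%N ->
  0 <= x (n%:Z - i%:Z) /\ 0 <= y (n%:Z - i%:Z).

Let bx_ge0 i : (1 <= i < k.+1)%N -> 0 <= b i * x (n%:Z - i%:Z).
Proof. by move=> ik; have [? _] := xy_ge0 ik; rewrite mulr_ge0 ?b_ge0. Qed.

Let cy_ge0 i : (1 <= i < k.+1)%N -> 0 <= c i * y (n%:Z - i%:Z).
Proof. by move=> ik; have [_ ?] := xy_ge0 ik; rewrite mulr_ge0 ?c_ge0. Qed.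

Lemma affine_form_ge_const : a <= affine_form k a b c x y n.
Proof.
have := sumr_nat_ge0 bx_ge0; have := sumr_nat_ge0 cy_ge0.
by rewrite /affine_form /=; lra.
Qed.

Lemma affine_form_ge0 : 0 <= affine_form k a b c x y n.
Proof. exact: le_trans affine_form_ge_const. Qed.

Lemma affine_form_ge_x j : (1 <= j <= k)%N ->
  b j * x (n%:Z - j%:Z) <= affine_form k a b c x y n.
Proof.
move=> jk; have := ler_term_sum_nat bx_ge0 jk.
have := sumr_nat_ge0 cy_ge0; have := a_ge0.
by rewrite /affine_form /=; lra.
Qed.

Lemma affine_form_ge_y j : (1 <= j <= k)%N ->
  c j * y (n%:Z - j%:Z) <= affine_form k a b c x y n.
Proof.
move=> jk; have := ler_term_sum_nat cy_ge0 jk.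
have := sumr_nat_ge0 bx_ge0; have := a_ge0.
by rewrite /affine_form /=; lra.
Qed.

End AffineForm.

(** * Growth estimates along a solution *)

Section Bounds.
Variables (R : realType) (k : nat) (sys : rational_system R).
Hypothesis sys_ge0 : nonneg_params k sys.

(** By strong induction: each new term is a quotient of a non-negative numerator, built from earlier
    or initial values, by a denominator that [is_solution] makes positive. *)
Lemma solution_ge0 (x y : int -> R) : (0 < k)%N -> is_solution k sys x y ->
  forall m : int, 1 - k%:Z <= m -> 0 <= x m /\ 0 <= y m.
Proof.
move=> k_gt0 [init rec].
suff nat_ge0 n : 0 <= x n%:Z /\ 0 <= y n%:Z.
  by case=> n km; [exact: nat_ge0 | apply: init; lia].
elim/ltn_ind: n => -[|n] IH; first by apply: init; lia.
have prev_ge0 i : (1 <= i <= k)%N ->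
    0 <= x (n.+1%:Z - i%:Z) /\ 0 <= y (n.+1%:Z - i%:Z).
  move=> ik; case: (leqP i n.+1) => ni; last by apply: init; lia.
  by rewrite subzn //; apply: IH; lia.
have [dx dy -> ->] := rec n.+1 isT.
have [[? ? ?] _ [? ? ?] _] := sys_ge0.
by split; apply: divr_ge0; rewrite ?(ltW dx) ?(ltW dy) //;
  apply: affine_form_ge0.
Qed.

Lemma solution_prev_ge0 (x y : int -> R) : (0 < k)%N -> is_solution k sys x y ->
  forall n : nat, (0 < n)%N -> forall i : nat, (1 <= i <= k)%N ->
  0 <= x (n%:Z - i%:Z) /\ 0 <= y (n%:Z - i%:Z).
Proof. by move=> k0 sol n n0 i ik; apply: solution_ge0 sol _ _ => //; lia. Qed.

(* The quotients [gamma_i / C_i] with [C_i = 0] are harmless: then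
   [gamma_i = 0] as well. *)
Definition x_offset : R :=
  alpha sys / cA sys + \sum_(1 <= i < k.+1) gamma sys i / cC sys i.

(** With [S] the sum of the [beta_i], the 2 ensures [S * step_factor <= 1/2], and the added 1 keeps
    the factor positive even when [S = 0]. *)
Definition step_factor : R := (2 * (1 + \sum_(1 <= i < k.+1) beta sys i))^-1.

Lemma x_offset_ge0 : 0 <= x_offset.
Proof.
have [[? _ g0] [? _ C0] _ _] := sys_ge0.
rewrite addr_ge0 ?divr_ge0 ?sumr_nat_ge0 // => i ik.
by rewrite divr_ge0 ?g0 ?C0.
Qed.

Lemma sum_beta_ge0 : 0 <= \sum_(1 <= i < k.+1) beta sys i.
Proof. by have [[_ b0 _] _ _ _] := sys_ge0; exact: sumr_nat_ge0. Qed.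

Lemma step_factor_gt0 : 0 < step_factor.
Proof. by rewrite invr_gt0; have := sum_beta_ge0; lra. Qed.

Hypotheses (A_gt0 : 0 < cA sys)
  (gamma_sub_C : {subset index_set k (gamma sys) <= index_set k (cC sys)}).

(** The denominator dominates both [A] and each [C_i y_(n-i)], so it absorbs [alpha] with ratio
    [alpha / A] and the [gamma_i] terms with ratios [gamma_i / C_i]. *)
Lemma x_num_le (x y : int -> R) (n : nat) :
  (forall i : nat, (1 <= i <= k)%N ->
    0 <= x (n%:Z - i%:Z) /\ 0 <= y (n%:Z - i%:Z)) ->
  x_num k sys x y n <= x_offset * x_den k sys x y n +
    \sum_(1 <= i < k.+1) beta sys i * x (n%:Z - i%:Z).
Proof.
move=> xy0; have [[a0 b0 g0] [A0 B0 C0] _ _] := sys_ge0.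
set D := x_den k sys x y n.
have aD : alpha sys <= alpha sys / cA sys * D.
  rewrite mulrAC ler_pdivlMr // ler_wpM2l //.
  exact: affine_form_ge_const.
have gD : \sum_(1 <= i < k.+1) gamma sys i * y (n%:Z - i%:Z) <=
    (\sum_(1 <= i < k.+1) gamma sys i / cC sys i) * D.
  rewrite mulr_suml; apply: ler_sum_nat => i ik.
  have [->|gN0] := eqVneq (gamma sys i) 0; first by rewrite !mul0r.
  have /gamma_sub_C/andP[_ Ci0] : i \in index_set k (gamma sys).
    by rewrite inE ltnS in ik *; rewrite ik lt0r gN0 g0.
  rewrite -mulrA ler_wpM2l ?g0 // mulrC ler_pdivlMr // mulrC.
  exact: affine_form_ge_y.
by rewrite /x_num /affine_form /x_offset mulrDl; lra.
Qed.

(** If every [i] in [I_beta] failed, the [beta] sum would be at most half of [x_n * den_n]. Then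
    [x_n * den_n <= K * den_n + x_n * den_n / 2], with [K] the offset, forcing [x_n <= 2K]. *)
Lemma large_step (x y : int -> R) (n : nat) :
  (0 < k)%N -> is_solution k sys x y -> (0 < n)%N ->
  2 * x_offset < x n%:Z ->
  exists2 i : nat, i \in index_set k (beta sys) &
    step_factor * x_den k sys x y n * x n%:Z <= x (n%:Z - i%:Z).
Proof.
move=> k0 sol n0 xK; have xy0 := solution_prev_ge0 k0 sol n0.
have [[_ b0 _] _ _ _] := sys_ge0.
have [D0 _ xE _] := sol.2 n n0.
set D := x_den k sys x y n in D0 xE *.
have [/hasP[i]|/hasPn none] := boolP (has (fun i =>
    (i \in index_set k (beta sys)) &&
    (step_factor * D * x n%:Z <= x (n%:Z - i%:Z))) (index_iota 1 k.+1)).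
  by move=> _ /andP[]; exists i.
have x0 : 0 <= x n%:Z by have := x_offset_ge0; lra.
have b_le : \sum_(1 <= i < k.+1) beta sys i * x (n%:Z - i%:Z) <=
    (\sum_(1 <= i < k.+1) beta sys i) * (step_factor * D * x n%:Z).
  rewrite mulr_suml; apply: ler_sum_nat => i ik.
  have [->|bN0] := eqVneq (beta sys i) 0; first by rewrite !mul0r.
  rewrite ler_wpM2l ?b0 // ltW // ltNge.
  have := none i; rewrite mem_index_iota ik => /(_ isT).
  by rewrite inE -ltnS ik lt0r bN0 b0.
have s_le : (\sum_(1 <= i < k.+1) beta sys i) * step_factor <= 2^-1.
  have S0 := sum_beta_ge0; rewrite /step_factor ler_pdivrMr; lra.
have := x_num_le xy0; rewrite -/D => num_le.
have xD : x n%:Z * D <= x_offset * D + 2^-1 * (x n%:Z * D).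
  rewrite {1}xE divfK ?gt_eqF //; apply: le_trans num_le _.
  rewrite lerD2l; apply: le_trans b_le _.
  rewrite -mulrA mulrA (mulrC D); apply: ler_wpM2r s_le.
  by rewrite mulr_ge0 // ltW.
have : x n%:Z * D <= 2 * x_offset * D by lra.
by rewrite ler_pM2r // leNgt xK.
Qed.

(** One step loses at most the factor [step_factor * A], since the denominator is at least [A]. The
    cap at 1 makes the [eta]-th power a lower bound for all smaller powers. *)
Definition path_factor : R := Num.min 1 (step_factor * cA sys).

Lemma path_factor_gt0 : 0 < path_factor.
Proof. by rewrite lt_min ltr01 mulr_gt0 ?step_factor_gt0. Qed.

Lemma path_factor_le1 : path_factor <= 1.
Proof. by rewrite ge_min lexx. Qed.

(** Steps have length at most [k], so [eta] of them starting beyond [eta * k] stay at positive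
    indices; the bound on [x n] keeps every visited value above [2 * x_offset], where [large_step]
    applies. *)
Lemma large_path (x y : int -> R) (n eta : nat) :
  (0 < k)%N -> is_solution k sys x y -> (eta * k < n)%N ->
  2 * x_offset < path_factor ^+ eta * x n%:Z ->
  exists c pos : nat -> nat,
    [/\ pos 0 = n, forall m, c m \in index_set k (beta sys) &
        forall m, (m < eta)%N ->
        [/\ (0 < pos m)%N, pos m = (c m + pos m.+1)%N,
            step_factor * x_den k sys x y (pos m) * x (pos m)%:Z
              <= x (pos m.+1)%:Z &
            path_factor * x (pos m)%:Z <= x (pos m.+1)%:Z]].
Proof.
move=> k0 sol n_gt x_gt.
have r0 := path_factor_gt0; have r1 := path_factor_le1.
have K0 := x_offset_ge0.
have x_ge0 (m : nat) : 0 <= x m%:Z.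
  by have [] := solution_ge0 k0 sol (m := m%:Z) ltac:(lia).
(* The choice must lie in [I_beta] at every position, so where [large_step] does not apply, the
   index it yields at [n] serves as a default. *)
have step_ex (p : nat) : exists i : nat, (i \in index_set k (beta sys)) &&
    ((0 < p)%N && (2 * x_offset < x p%:Z) ==>
     (step_factor * x_den k sys x y p * x p%:Z <= x (p%:Z - i%:Z))).
  have [/andP[p0 xp]|_] := boolP ((0 < p)%N && (2 * x_offset < x p%:Z)).
    by have [i ib ix] := large_step k0 sol p0 xp; exists i; rewrite ib.
  have [||i ib _] := @large_step x y n k0 sol; first by lia.
    apply: lt_le_trans x_gt _; rewrite ler_piMl ?exprn_ile1 //.
    exact: ltW.
  by exists i; rewrite ib.
have [step stepP] : exists step : nat -> nat, forall p,
    step p \in index_set k (beta sys) /\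
    ((0 < p)%N -> 2 * x_offset < x p%:Z ->
     step_factor * x_den k sys x y p * x p%:Z <= x (p%:Z - (step p)%:Z)).
  exists (fun p => xchoose (step_ex p)) => p.
  have /andP[? /implyP le_p] := xchooseP (step_ex p).
  by split=> // p0 xp; apply: le_p; rewrite p0.
pose pos m := iter m (fun p => p - step p)%N n.
have step_le p : (step p <= k)%N by have /andP[/andP[]] := (stepP p).1.
have pos_ge m : (n <= pos m + m * k)%N.
  elim: m => [|m IH]; first by rewrite addn0.
  by rewrite /pos iterS -/(pos m) mulSn; have := step_le (pos m); lia.
have pos_gt m : (m <= eta)%N -> (0 < pos m)%N.
  move=> mle; have := pos_ge m.
  by have : (m * k <= eta * k)%N by [rewrite leq_mul2r mle orbT]; lia.
have large m : (m < eta)%N -> 2 * x_offset < x (pos m)%:Z ->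
    [/\ pos m = (step (pos m) + pos m.+1)%N,
        step_factor * x_den k sys x y (pos m) * x (pos m)%:Z
              <= x (pos m.+1)%:Z &
        path_factor * x (pos m)%:Z <= x (pos m.+1)%:Z].
  move=> mlt xm; have pm0 := pos_gt _ (ltnW mlt).
  (* The next position is positive, so the subtraction on [nat] was not truncated. *)
  have sp : (step (pos m) <= pos m)%N.
    by have := pos_gt _ mlt; rewrite /pos iterS; lia.
  have xle : step_factor * x_den k sys x y (pos m) * x (pos m)%:Z
      <= x (pos m.+1)%:Z by have := (stepP (pos m)).2 pm0 xm; rewrite subzn.
  split=> //; first by rewrite /pos iterS -/(pos m) subnKC.
  apply: le_trans xle; apply: ler_wpM2r => //.
  rewrite ge_min; apply/orP; right; apply: ler_wpM2l.
    exact/ltW/step_factor_gt0.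
  have [[_ _ _] [? ? ?] _ _] := sys_ge0.
  by apply: affine_form_ge_const => //; exact: solution_prev_ge0 sol _ _.
have pow m : (m <= eta)%N -> path_factor ^+ m * x n%:Z <= x (pos m)%:Z ->
    2 * x_offset < x (pos m)%:Z.
  move=> mle; apply: lt_le_trans; apply: lt_le_trans x_gt _.
  by rewrite ler_wpM2r // ler_wiXn2l // ltW.
have xpos m : (m <= eta)%N -> path_factor ^+ m * x n%:Z <= x (pos m)%:Z.
  elim: m => [|m IH] mle; first by rewrite expr0 mul1r.
  have [_ _] := large m mle (pow m (ltnW mle) (IH (ltnW mle))).
  apply: le_trans; rewrite exprS -mulrA ler_wpM2l ?(ltW r0) //.
  exact/IH/ltnW.
exists (step \o pos), pos; split=> [//|m|m mlt]; first exact: (stepP _).1.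
have mle := ltnW mlt.
have [? ? ?] := large m mlt (pow m mle (xpos m mle)).
by split=> //; exact: pos_gt.
Qed.

End Bounds.

(** * Accumulating steps along a path *)

Lemma telescope_sum_nat (c pos : nat -> nat) (a b : nat) : (a <= b)%N ->
  (forall m, (a <= m < b)%N -> pos m = (c m + pos m.+1)%N) ->
  pos a = (\sum_(a <= m < b) c m + pos b)%N.
Proof.
move=> ab; rewrite -(subnKC ab); elim: (b - a)%N => [|d IH] step.
  by rewrite addn0 big_geq.
rewrite IH => [|m mP]; last by apply: step; lia.
by rewrite addnS big_nat_recr ?leq_addr //= step; lia.
Qed.

Lemma geometric_ge (R : realDomainType) (r : R) (u : nat -> R) (a b : nat) :
  0 <= r -> (a <= b)%N ->
  (forall m, (a <= m < b)%N -> r * u m <= u m.+1) ->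
  r ^+ (b - a) * u a <= u b.
Proof.
move=> r0 /subnKC <-; rewrite addKn.
elim: (b - a)%N => [|d IH] step; first by rewrite addn0 expr0 mul1r.
rewrite addnS; apply: le_trans (step _ _); last by lia.
rewrite exprS -mulrA ler_wpM2l //; apply: IH => m mP; apply: step; lia.
Qed.

Theorem theorem7 (R : realType) (k : nat) (k_gt0 : (0 < k)%N)
    (sys : rational_system R) (sys_ge0 : nonneg_params k sys)
    (A_gt0 : 0 < cA sys)
    (gamma_sub_C : {subset index_set k (gamma sys) <= index_set k (cC sys)})
    (beta_B : exists eta : nat, (0 < eta)%N /\
       forall c : nat -> nat,
         (forall m : nat, (1 <= m)%N -> c m \in index_set k (beta sys)) ->
         exists N1 N2 : nat,
           [/\ (1 <= N1 <= eta)%N, (1 <= N2 <= eta)%N &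
               (\sum_(N1 <= m < N2.+1) c m)%N \in index_set k (cB sys)]) :
  exists (M : R) (N : nat),
    [/\ 0 < M, (1 <= N)%N &
        forall x y : int -> R, is_solution k sys x y ->
          forall n : nat, (N < n)%N -> x n%:Z <= M].
Proof.
have [eta [eta0 blocks]] := beta_B.
pose r := path_factor k sys; pose s := step_factor k sys.
pose K := x_offset k sys.
have r0 : 0 < r := path_factor_gt0 sys_ge0 A_gt0.
have r1 : r <= 1 := path_factor_le1 k sys.
have s0 : 0 < s := step_factor_gt0 sys_ge0.
have K0 : 0 <= K := x_offset_ge0 sys_ge0.
have [_ [_ B0 C0] _ _] := sys_ge0.
have re0 : 0 < r ^+ eta by rewrite exprn_gt0.
(* The terms with [B_j = 0] contribute [0^-1 = 0]. *)
pose L := \sum_(1 <= j < k.+1) (r ^+ eta * (s * cB sys j))^-1.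
have L_ge0 j : (1 <= j < k.+1)%N -> 0 <= (r ^+ eta * (s * cB sys j))^-1.
  by move=> jk; rewrite invr_ge0 !mulr_ge0 ?B0 // ltW.
have L0 : 0 <= L := sumr_nat_ge0 L_ge0.
(* Exceeding [M] must leave, after [eta] losses, a value above both [2K], so that the path exists,
   and [L], which the block will contradict. *)
pose M := (2 * K + L + 1) / r ^+ eta.
have rM : r ^+ eta * M = 2 * K + L + 1 by rewrite mulrC divfK ?gt_eqF.
exists M, (eta * k)%N; split; [|by rewrite muln_gt0 eta0|].
  by rewrite divr_gt0 //; lra.
move=> x y sol n n_gt; rewrite leNgt; apply/negP => xM.
have x_gt : 2 * K + L + 1 < r ^+ eta * x n%:Z by rewrite -rM ltr_pM2l.
have K_lt : 2 * K < r ^+ eta * x n%:Z by lra.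
have [c [pos [pos0 c_in pos_step]]] :=
  large_path sys_ge0 A_gt0 gamma_sub_C k_gt0 sol n_gt K_lt.
have x_ge0 (m : nat) : 0 <= x m%:Z.
  by have [] := solution_ge0 sys_ge0 k_gt0 sol (m := m%:Z) ltac:(lia).
have descend a b : (a <= b <= eta)%N ->
    r ^+ eta * x (pos a)%:Z <= x (pos b)%:Z.
  move=> /andP[ab be].
  apply: le_trans (geometric_ge (u := fun m => x (pos m)%:Z) (ltW r0) ab _).
    rewrite ler_wpM2r // ler_wiXn2l ?(ltW r0) //.
    exact: leq_trans (leq_subr _ _) be.
  by move=> m /andP[_ mb]; have [] := pos_step m (leq_trans mb be).
(* Blocks are numbered from 1 and path steps from 0, hence the shift by [predn]: with [N1 = a + 1]
   and [N2 = b], the block leads from [pos a] to [pos b]. *)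
have [[|a] [b []]] := blocks (c \o predn) (fun m _ => c_in m.-1).
  by [].
move=> /andP[_ ae] /andP[_ be]; rewrite big_add1 /=.
set j := (\sum_(a <= m < b) c m)%N => /andP[jk Bj0].
(* An empty block would have sum 0, which is not an index in [1, ..., k]. *)
have ab : (a < b)%N.
  by rewrite ltnNge; apply/negP => ba; rewrite /j big_geq in jk.
have posE : pos a = (j + pos b)%N.
  apply: telescope_sum_nat => [|m /andP[_ mb]]; first exact: ltnW.
  by have [] := pos_step m (leq_trans mb be).
have [pa0 _ xstep _] := pos_step a ae.
have xa_gt : 2 * K + L + 1 < x (pos a)%:Z.
  by apply: lt_le_trans x_gt _; rewrite -pos0; apply: descend; exact: ltnW.
have xb_gt0 : 0 < x (pos b)%:Z.
  have : r ^+ eta * x n%:Z <= x (pos b)%:Z by rewrite -pos0; apply: descend.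
  by lra.
have den_ge : cB sys j * x (pos b)%:Z <= x_den k sys x y (pos a).
  have -> : (pos b)%:Z = (pos a)%:Z - j%:Z by rewrite posE PoszD addrC addKr.
  apply: affine_form_ge_x => //; first exact: ltW.
  exact: solution_prev_ge0 sol _ _.
pose T := r ^+ eta * (s * cB sys j).
have T0 : 0 < T by rewrite !mulr_gt0.
(* The first step of the block retains the full denominator, which contains [B_j x_(pos b)]; the
   remaining steps lose at most [r ^+ eta]. *)
have xb_ge : T * x (pos a)%:Z * x (pos b)%:Z <= x (pos b)%:Z.
  apply: le_trans (descend a.+1 b _); last by rewrite ab.
  have -> : T * x (pos a)%:Z * x (pos b)%:Z =
      r ^+ eta * (s * (cB sys j * x (pos b)%:Z) * x (pos a)%:Z).
    by rewrite /T; ring.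
  rewrite ler_wpM2l ?(ltW re0) //; apply: le_trans xstep.
  by rewrite ler_wpM2r // ler_wpM2l ?(ltW s0).
have TL : T^-1 <= L := ler_term_sum_nat L_ge0 jk.
(* Cancelling [x_(pos b) > 0] gives [x_(pos a) <= T^-1 <= L], against [xa_gt]. *)
have : T * x (pos a)%:Z <= 1 by rewrite -(ler_pM2r xb_gt0) mul1r.
by rewrite mulrC -ler_pdivlMr // mul1r; lra.
Qed.
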